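(* Let $G$ be a unicyclic graph of Type $II$, let $C$ be its cycle, and let $T_1,\ldots,T_k$ be the connected components of $G-C$, so that $G-C=\bigcup_{i=1}^{k}T_i$. Then $$\alpha(G)=\left\lfloor\frac{|V(C)|}{2}\right\rfloor+\sum_{i=1}^{k}\left(|Supp(T_i)|+\frac{|V(\mathcal{F}_N(T_i))|}{2}\right).$$
   Context: All graphs are finite and simple. A unicyclic graph is a connected graph containing exactly one cycle. For a graph $H$ with adjacency matrix $A(H)$, $\mathcal{N}(H)=\{x\in\mathbb{R}^{V(H)}: A(H)x=0\}$ and the support of $H$ is $Supp(H)=\{u\in V(H): x_u\neq 0 \text{ for some } x\in\mathcal{N}(H)\}$. For a subgraph $H$ of $G$, $G-H$ is the subgraph of $G$ induced by $V(G)\setminus V(H)$. $\alpha(G)$ denotes the independence number of $G$ (the maximum cardinality of an independent set). For a unicyclic graph $G$ with cycle $C$ and $v\in V(C)$, the pendant tree $G\{v\}$ of $G$ at $v$ is the induced connected subgraph of $G$ with the maximum possible number of vertices which contains $v$ and no other vertex of $C$ (it may consist of $v$ alone). The vertex $v$ is called mismatched in $G\{v\}$ if some maximum matching of $G\{v\}$ does not saturate $v$ (if $G\{v\}$ consists of a single vertex, $v$ is mismatched), and matched in $G\{v\}$ otherwise. $G$ is of Type $I$ if some vertex $v\in V(C)$ is matched in $G\{v\}$; otherwise $G$ is of Type $II$. For a tree $T$, the $S$-forest $\mathcal{F}_S(T)$ is the subgraph of $T$ induced by the closed neighborhood $N[Supp(T)]$, i.e. by $Supp(T)$ together with all neighbors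 of vertices of $Supp(T)$; the $N$-forest is $\mathcal{F}_N(T)=T-\mathcal{F}_S(T)$. *)

(* Defs.v *)
From mathcomp Require Import all_boot all_order all_algebra.
From mathcomp Require Import boolp reals.
Set Implicit Arguments.
Unset Strict Implicit.
Unset Printing Implicit Defensive.
Import GRing.Theory Num.Theory.
Local Open Scope ring_scope.

(* A finite simple graph is a symmetric irreflexive relation [e] on a finType. *)
(* An induced subgraph is represented by its vertex set [S : {set T}]; the     *)
(* whole graph is [S = [set: T]].                                              *)

Definition adj_in (T : finType) (e : rel T) (S : {set T}) : rel T :=
  [rel x y | [&& x \in S, y \in S & e x y]].

Definition edges_in (T : finType) (e : rel T) (S : {set T}) : {set {set T}} :=
  [set [set p.1; p.2] | p : T * T & adj_in e S p.1 p.2].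

Definition connected_in (T : finType) (e : rel T) (S : {set T}) : bool :=
  (S != set0) && [forall x in S, forall y in S, connect (adj_in e S) x y].

Definition components (T : finType) (e : rel T) (S : {set T}) : {set {set T}} :=
  equivalence_partition (connect (adj_in e S)) S.

Definition independent (T : finType) (e : rel T) (A : {set T}) : bool :=
  [forall x in A, forall y in A, ~~ e x y].

Definition alpha (T : finType) (e : rel T) : nat :=
  (\max_(A : {set T} | independent e A) #|A|)%N.

Definition graph_cycle (T : finType) (e : rel T) (c : seq T) : Prop :=
  (2 < size c)%N /\ ucycle e c.

(* Two vertex sequences describe the same cycle (as a subgraph) exactly when   *)
(* they have the same edge set.                                                *)
Definition cycle_edges (T : finType) (c : seq T) : {set {set T}} :=
  [set [set x; next c x] | x in c].

Definition unicyclic (T : finType) (e : rel T) : Prop :=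
  connected_in e [set: T] /\
  exists2 c : seq T, graph_cycle e c &
    forall c' : seq T, graph_cycle e c' -> cycle_edges c' = cycle_edges c.

Definition matching (T : finType) (e : rel T) (S : {set T})
    (M : {set {set T}}) : bool :=
  (M \subset edges_in e S) && trivIset M.

Definition maximum_matching (T : finType) (e : rel T) (S : {set T})
    (M : {set {set T}}) : Prop :=
  matching e S M /\
  forall M' : {set {set T}}, matching e S M' -> (#|M'| <= #|M|)%N.

(* [cover M] is the set of vertices saturated by [M]. *)
Definition mismatched (T : finType) (e : rel T) (S : {set T}) (v : T) : Prop :=
  exists2 M : {set {set T}}, maximum_matching e S M & v \notin cover M.

Definition matched (T : finType) (e : rel T) (S : {set T}) (v : T) : Prop :=
  ~ mismatched e S v.

(* Meaningful for [v \in C], in which case [[set v]] satisfies the constraint. *)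
Definition pendant_tree (T : finType) (e : rel T) (C : {set T}) (v : T) :
    {set T} :=
  [arg max_(S > [set v] | connected_in e S && (S :&: C == [set v])) #|S|]%N.

Definition typeI (T : finType) (e : rel T) (C : {set T}) : Prop :=
  exists2 v : T, v \in C & matched e (pendant_tree e C v) v.

Definition typeII (T : finType) (e : rel T) (C : {set T}) : Prop :=
  ~ typeI e C.

Definition adjmx (R : realType) (T : finType) (e : rel T) (S : {set T}) :
    'M[R]_#|S| :=
  \matrix_(i, j) (e (enum_val i) (enum_val j))%:R.

Definition supp (R : realType) (T : finType) (e : rel T) (S : {set T}) :
    {set T} :=
  [set enum_val i | i : 'I_#|S| &
     `[< exists2 x : 'cV[R]_#|S|, adjmx R e S *m x = 0 & x i 0 != 0 >]].

Definition S_forest (R : realType) (T : finType) (e : rel T) (S : {set T}) :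
    {set T} :=
  [set u in S | (u \in supp R e S) || [exists v in supp R e S, e v u]].

Definition N_forest (R : realType) (T : finType) (e : rel T) (S : {set T}) :
    {set T} :=
  S :\: S_forest R e S.

(* Main.v *)
(** Every cycle of [G] has vertex set [C], so [G - C] is a forest and each
    component [K] of it is joined to [C] through a single vertex.  Removing a
    leaf with its neighbour shows by induction that a forest has an independent
    set [I] and a matching [M] with [|I| + |M|] equal to its order (so both are
    maximum) and that [|I| = |Supp| + |F_N| / 2].  In Type II the vertex [u] of
    [K] attached to [C] is saturated by every maximum matching of [K]; the
    duality for [K - u] then gives a maximum independent set of [K] avoiding
    [u].  These sets are compatible with any independent set of [C], hence
    [alpha(G)] is the sum of the independence numbers of [C] and of the
    components. *)

Require Import Defs.
From mathcomp Require Import all_boot all_order all_algebra.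
From mathcomp Require Import boolp reals zify.
Set Implicit Arguments.
Unset Strict Implicit.
Unset Printing Implicit Defensive.
Import GRing.Theory Num.Theory.
Local Open Scope ring_scope.

(** * Cycles and leaves in induced subgraphs *)

Definition acyclic_in (T : finType) (e : rel T) (S : {set T}) : Prop :=
  forall c : seq T, graph_cycle e c -> ~ {subset c <= S}.

Section Graph.
Variables (T : finType) (e : rel T).
Hypotheses (e_sym : symmetric e) (e_irr : irreflexive e).
Implicit Types (S A B I K : {set T}) (M : {set {set T}}).

Lemma acyclic_inS S S' : S' \subset S -> acyclic_in e S -> acyclic_in e S'.
Proof. by move=> /subsetP sub acS c cc cS'; apply: (acS c cc) => x /cS' /sub. Qed.

Lemma connect_in_sym S : connect_sym (adj_in e S).
Proof. by apply: sym_connect_sym => x y; rewrite /adj_in /= e_sym andbCA. Qed.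

Lemma connect_inP S x y : x \in S -> connect (adj_in e S) x y ->
  exists p, [/\ path e x p, uniq (x :: p), last x p = y & {subset x :: p <= S}].
Proof.
move=> xS /connectP [p0 p0P ->].
case: (shortenP p0P) => p pP up _.
exists p; split=> //.
  by apply: sub_path pP => a b /and3P[].
elim: p x xS pP {up p0 p0P} => [|z p IH] x xS /=.
  by move=> _ w; rewrite inE => /eqP ->.
move=> /andP[/and3P[_ zS _] pP] w; rewrite inE => /orP[/eqP -> //|].
exact: IH.
Qed.

(** Simple paths in the disjoint sets [A] and [B] are concatenated and closed by the two edges. The
    last hypothesis makes one path nontrivial, so that at least three vertices occur. *)
Lemma join_cycle A B a1 a2 b1 b2 :
    [disjoint A & B] -> a1 \in A -> b1 \in B ->
    connect (adj_in e A) a1 a2 -> connect (adj_in e B) b1 b2 ->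
    e a2 b1 -> e b2 a1 -> (a1 != a2) || (b1 != b2) ->
  exists2 c, graph_cycle e c &
    [/\ a1 \in c, b1 \in c & {subset c <= A :|: B}].
Proof.
move=> dAB a1A b1B /(connect_inP a1A)[p [pP up <- sp]].
move=> /(connect_inP b1B)[q [qP uq <- sq]] eab eba neq.
exists ((a1 :: p) ++ (b1 :: q)).
  split; last first.
    apply/andP; split.
      by rewrite /= rcons_cat cat_path pP /= eab rcons_path qP eba.
    rewrite cat_uniq up uq andbT; apply/hasPn => z zq; apply/negP => zp.
    by move/pred0P: dAB => /(_ z) /=; rewrite (sp _ zp) (sq _ zq).
  rewrite size_cat /= addnS addSn !ltnS.
  by case: p q neq {pP up sp qP uq sq eab eba} => [|? ?] [|? ?] //=; rewrite !eqxx.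
split; rewrite ?mem_cat ?mem_head ?orbT // => z.
by rewrite mem_cat => /orP[/sp|/sq] zAB; rewrite in_setU zAB ?orbT.
Qed.

(** Without a leaf, a simple path could always be prolonged at its head: a neighbour of the head
    other than the second vertex cannot lie on the path without closing a cycle. Finiteness of [S]
    forbids this. *)
Lemma acyclic_leaf S : acyclic_in e S ->
    (exists x y, adj_in e S x y) ->
  exists p q, [/\ p \in S, q \in S, e p q & forall z, z \in S -> e p z -> z = q].
Proof.
move=> acS [x0 [y0 /and3P[x0S y0S e0]]]; apply: contrapT => noleaf.
have long n : exists x y p, [/\ path e x (y :: p), uniq [:: x, y & p],
    {subset [:: x, y & p] <= S} & size p = n].
  elim: n => [|n [x [y [p [pP up sp szp]]]]].
    exists x0, y0, [::]; split => //=; first by rewrite e0.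
      by rewrite inE andbT; apply/eqP => eq0; rewrite eq0 e_irr in e0.
    by move=> z; rewrite !inE => /orP[] /eqP ->.
  have xS : x \in S by apply: sp; rewrite mem_head.
  have yS : y \in S by apply: sp; rewrite !inE eqxx orbT.
  have exy : e x y by case/andP: pP.
  have [z [zS exz zy]] : exists z, [/\ z \in S, e x z & z <> y].
    apply: contrapT => nz; apply: noleaf; exists x, y; split=> // z zS exz.
    by apply: contrapT => zy; apply: nz; exists z.
  (* If [z] is on the path, the initial segment up to [z] and the edge back to [x] form a cycle
     inside [S]. *)
  have [zp|zp] := boolP (z \in p).
    case/path.splitP: zp pP up sp {szp} => p1 p2.
    rewrite -cat_cons -!cat_cons cat_path => /andP[pP _].
    rewrite cat_uniq => /andP[up _] sp.
    exfalso; apply: (acS [:: x, y & rcons p1 z]).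
      split; first by rewrite /= size_rcons.
      apply/andP; split=> //=.
      by rewrite rcons_path last_rcons (e_sym z) exz andbT.
    by move=> w wp; apply: sp; rewrite mem_cat wp.
  exists z, x, (y :: p); split=> /=.
  - by rewrite e_sym exz; case/andP: pP => ->.
  - rewrite !inE (negbTE zp) orbF; apply/andP; split=> //.
    rewrite negb_or; apply/andP; split; last exact/eqP.
    by apply/eqP => zx; rewrite zx e_irr in exz.
  - by move=> w; rewrite inE => /orP[/eqP -> //|/sp].
  - by rewrite szp.
(* This path has [#|S| + 2] distinct vertices, all in [S]. *)
have [x [y [p [_ up sp szp]]]] := long #|S|.
have := uniq_leq_size up (s2 := enum S).
rewrite -cardE /= szp => /(_ _) ; rewrite ltnNge leqnSn => H.
by have : false by apply: H => w /sp; rewrite mem_enum.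
Qed.

(** * Matchings and independent sets *)

Lemma matchingP S M :
  reflect ((forall m, m \in M -> exists x y, m = [set x; y] /\ adj_in e S x y)
           /\ trivIset M) (matching e S M).
Proof.
apply: (iffP andP) => -[sM tM]; split=> //.
  by move=> m /(subsetP sM) /imsetP [[x y] /=]; rewrite inE => xy ->; exists x, y.
apply/subsetP => m /sM [x [y [-> xy]]]; apply/imsetP; exists (x, y) => //.
by rewrite inE.
Qed.

Lemma matching_cover S M : matching e S M -> cover M \subset S.
Proof.
move=> /matchingP[sM _]; apply/bigcupsP => m /sM [x [y [-> /and3P[xS yS _]]]].
by apply/subsetP => z; rewrite !inE => /orP[] /eqP ->.
Qed.

Lemma matchingS S S' M : S \subset S' -> matching e S M -> matching e S' M.
Proof.
move=> /subsetP sub /matchingP[sM tM]; apply/matchingP; split=> // m /sM.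
move=> [x [y [-> /and3P[xS yS exy]]]]; exists x, y; split=> //.
by rewrite /adj_in /= !sub.
Qed.

Lemma matching_sub S M M' : M' \subset M -> matching e S M -> matching e S M'.
Proof.
move=> sub /andP[sM tM]; rewrite /matching (subset_trans sub sM).
exact: trivIsetS sub tM.
Qed.

(** Edges are nonempty, so disjoint covers force [M] and [M'] to have no common edge. *)
Lemma matchingU S M M' : matching e S M -> matching e S M' ->
  [disjoint cover M & cover M'] ->
  matching e S (M :|: M') /\ #|M :|: M'| = (#|M| + #|M'|)%N.
Proof.
move=> mM mM' dis; have [sM tM] := andP mM; have [sM' tM'] := andP mM'.
split.
  by rewrite /matching subUset sM sM' trivIsetU.
rewrite cardsU -[RHS]subn0; congr (_ - _)%N; apply/eqP; rewrite cards_eq0 -subset0.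
apply/subsetP => m /setIP[mM1 mM2]; exfalso.
have /matchingP[/(_ _ mM1)[x [y [mE _]]] _] := mM.
have xm : x \in m by rewrite mE !inE eqxx.
move/pred0P: dis => /(_ x) /=.
have -> : x \in cover M by apply/bigcupP; exists m.
by have -> : x \in cover M' by apply/bigcupP; exists m.
Qed.

Lemma matching1 S x y : adj_in e S x y -> matching e S [set [set x; y]].
Proof.
move=> xy; apply/matchingP; split; first by move=> m /set1P ->; exists x, y.
by apply/trivIsetP => A B /set1P -> /set1P ->; rewrite eqxx.
Qed.

Lemma cover1 (A : {set T}) : cover [set A] = A.
Proof. by rewrite /cover big_set1. Qed.

Lemma independentP A :
  reflect {in A &, forall x y, ~~ e x y} (independent e A).
Proof.
apply: (iffP forall_inP) => iA x.
  by move=> y xA yA; move/forall_inP: (iA x xA) => /(_ y yA).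
by move=> xA; apply/forall_inP => y; apply: iA.
Qed.

Lemma independentS A B : A \subset B -> independent e B -> independent e A.
Proof.
move=> /subsetP sub /independentP iB; apply/independentP => x y /sub xB /sub yB.
exact: iB.
Qed.

(** Each edge of [M] has an endpoint outside [I], and distinct edges give distinct endpoints, so [M]
    injects into [S :\: I]. *)
Lemma independent_matching_bound S I M : I \subset S -> independent e I ->
  matching e S M -> (#|I| + #|M| <= #|S|)%N.
Proof.
move=> IS /independentP indI mM; have /matchingP[sM tM] := mM.
have ex m : m \in M -> exists x, (x \in m) && (x \notin I).
  move=> /sM [x [y [-> /and3P[_ _ exy]]]].
  have [xI|xI] := boolP (x \in I); last by exists x; rewrite !inE eqxx.
  exists y; rewrite !inE eqxx orbT /=; apply/negP => yI.
  by have := indI _ _ xI yI; rewrite exy.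
pose f (m : {set T}) := [pick x in m | x \notin I].
have fP m : m \in M -> exists2 x, f m = Some x & (x \in m) && (x \notin I).
  move=> /ex[x xP]; rewrite /f; case: pickP => [y yP|/(_ x)]; first by exists y.
  by rewrite xP.
have injf : {in M &, injective f}.
  move=> m m' mM1 mM2 feq; apply: contrapT => /eqP neq.
  have [x fx /andP[xm _]] := fP m mM1; have [y fy /andP[ym _]] := fP m' mM2.
  move: feq; rewrite fx fy => -[xy]; rewrite -{}xy in ym.
  have /trivIsetP/(_ m m' mM1 mM2 neq) /pred0P/(_ x) := tM.
  by rewrite /= xm ym.
rewrite -(card_in_imset injf) -(cardsID I S) (setIidPr IS) leq_add2l.
have injS : injective (@Some T) by move=> ? ? [].
rewrite -(card_imset (mem (S :\: I)) injS).
apply/subset_leq_card/subsetP => _ /imsetP[m mM1 ->].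
have [x -> /andP[xm xI]] := fP m mM1; apply/imsetP; exists x => //.
rewrite inE xI; apply: (subsetP (matching_cover mM)).
by apply/bigcupP; exists m.
Qed.

End Graph.

(** The null space of the adjacency matrix of [S], with vectors written as functions on all of [T],
    so that passing to a smaller [S] involves no change of index type. *)
Definition null_on (R : realType) (T : finType) (e : rel T) (S : {set T})
    (f : T -> R) : Prop :=
  {in S, forall y, \sum_(z in S | e y z) f z = 0}.

(** * Null vectors and the support *)

Section Support.
Variables (R : realType) (T : finType) (e : rel T).
Hypotheses (e_sym : symmetric e) (e_irr : irreflexive e).
Implicit Types (S I K : {set T}) (M : {set {set T}}) (f : T -> R).

Lemma mem_suppP S x :
  reflect (exists f, [/\ x \in S, null_on e S f & f x != 0]) (x \in supp R e S).
Proof.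
apply: (iffP imsetP) => [[i]|[f [xS nf fx]]].
  rewrite inE => /asboolP [v Av vi ->].
  (* [f] extends [v] by 0: the index of [z] in [enum S] is below [#|S|] exactly when [z] lies in
     [S]. *)
  pose f z := if insub (index z (enum S)) is Some j then v j 0 else 0.
  have fE j : f (enum_val j) = v j 0.
    have ltj : (index (enum_val j) (enum S) < #|S|)%N.
      by rewrite cardE index_mem mem_enum enum_valP.
    rewrite /f insubT; congr (v _ _); apply: val_inj => /=.
    by rewrite (enum_val_nth (enum_val j)) index_uniq ?enum_uniq // -cardE.
  exists f; split; [exact: enum_valP| |by rewrite fE].
  move=> y yS; rewrite big_mkcondr big_enum_val /=.
  have /matrixP/(_ (enum_rank_in yS y) 0) := Av.
  rewrite !mxE => sum0; rewrite -[RHS]sum0.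
  apply: eq_bigr => j _.
  by rewrite mxE fE enum_rankK_in //; case: (e y _); rewrite ?mul1r ?mul0r.
exists (enum_rank_in xS x); last by rewrite enum_rankK_in.
rewrite inE; apply/asboolP; exists (\col_j f (enum_val j)); last first.
  by rewrite mxE enum_rankK_in.
apply/matrixP => i j; rewrite !mxE; have := nf (enum_val i) (enum_valP i).
rewrite big_mkcondr big_enum_val /= => sum0; rewrite -[RHS]sum0; apply: eq_bigr => k _.
by rewrite !mxE; case: (e _ _); rewrite ?mul1r ?mul0r.
Qed.

Lemma supp_sub S : supp R e S \subset S.
Proof. by apply/subsetP => x /mem_suppP[f []]. Qed.

Lemma null_on_eq S f g : {in S, f =1 g} -> null_on e S f -> null_on e S g.
Proof.
move=> fg nf y yS; rewrite -[RHS](nf y yS); apply: eq_bigr => z /andP[zS _].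
by rewrite fg.
Qed.

(** Neighbours within [S] share a component, so the equation at each vertex either is unchanged or
    has only zero terms. *)
Lemma null_on_component S w f : null_on e S f ->
  null_on e S (fun z => if connect (adj_in e S) w z then f z else 0).
Proof.
move=> nf y yS; have [wy|wy] := boolP (connect (adj_in e S) w y).
  rewrite -[RHS](nf y yS); apply: eq_bigr => z /andP[zS yz].
  by rewrite (connect_trans wy) // connect1 // /adj_in /= yS zS yz.
rewrite big1 // => z /andP[zS yz]; case: ifP => // wz.
case/negP: wy; apply: connect_trans wz (connect1 _).
by rewrite /adj_in /= yS zS e_sym yz.
Qed.

Lemma supp_edgeless S : {in S &, forall x y, ~~ e x y} -> supp R e S = S.
Proof.
move=> noe; apply/eqP; rewrite eqEsubset supp_sub; apply/subsetP => x xS.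
apply/mem_suppP; exists (fun=> 1); split=> //; last exact: oner_neq0.
move=> y yS; rewrite big1 // => z /andP[zS yz].
by have := noe y z yS zS; rewrite yz.
Qed.

(** * Removing a leaf [p] together with its neighbour [q] *)

Section Leaf.
Variables (S : {set T}) (p q : T).
Hypotheses (pS : p \in S) (qS : q \in S) (pq : e p q).
Hypothesis leaf : forall z, z \in S -> e p z -> z = q.

Let S' := S :\: [set p; q].

Lemma leaf_neq : p != q.
Proof. by apply/eqP => E; move: pq; rewrite E e_irr. Qed.

Lemma leaf_card : #|S| = #|S'|.+2.
Proof.
rewrite -(cardsID [set p; q] S) (setIidPr _) ?cards2 ?leaf_neq //.
by apply/subsetP => z; rewrite !inE => /orP[] /eqP ->.
Qed.

Lemma in_leaf z : (z \in S') = [&& z != p, z != q & z \in S].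
Proof. by rewrite !inE negb_or andbA. Qed.

Lemma leaf_nonadj z : z \in S' -> e p z = false.
Proof.
rewrite in_leaf => /and3P[_ zq zS]; apply/negP => /(leaf zS) E.
by rewrite E eqxx in zq.
Qed.

Lemma sum_leaf (P : pred T) f : \sum_(z in S | P z) f z =
  (if P p then f p else 0) + ((if P q then f q else 0) + \sum_(z in S' | P z) f z).
Proof.
rewrite !big_mkcondr (bigD1 p) //= (bigD1 q) /=; last by rewrite qS eq_sym leaf_neq.
congr (_ + (_ + _)); apply: eq_bigl => z.
by rewrite in_leaf -andbA andbC andbA.
Qed.

(** The equation at [p] reads [f q = 0], the one at [q] then determines [f p], and those at the
    remaining vertices reduce to the equations of [S']. *)
Lemma null_on_leaf f : null_on e S f <->
  [/\ f q = 0, f p = - \sum_(z in S' | e q z) f z & null_on e S' f].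
Proof.
have sp : \sum_(z in S | e p z) f z = f q.
  rewrite sum_leaf e_irr pq add0r big1 ?addr0 // => z /andP[zS'].
  by rewrite leaf_nonadj.
have sq : \sum_(z in S | e q z) f z = f p + \sum_(z in S' | e q z) f z.
  by rewrite sum_leaf e_irr e_sym pq add0r.
have sy y : f q = 0 -> y \in S' ->
    \sum_(z in S | e y z) f z = \sum_(z in S' | e y z) f z.
  move=> fq yS'; rewrite sum_leaf fq e_sym leaf_nonadj //.
  by case: ifP; rewrite !add0r.
have subS y : y \in S' -> y \in S by rewrite in_leaf => /and3P[].
split=> [nf|[fq fp nf] y yS].
  have fq : f q = 0 by rewrite -sp nf.
  split=> //; last by move=> y yS'; rewrite -sy ?nf ?subS.
  by apply/eqP; rewrite -addr_eq0 -sq nf.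
have [->|yp] := eqVneq y p; first by rewrite sp.
have [->|yq] := eqVneq y q; first by rewrite sq fp addNr.
have yS' : y \in S' by rewrite in_leaf yp yq.
by rewrite sy ?nf.
Qed.

Lemma null_on_leaf_extend f : null_on e S' f ->
  exists g, [/\ null_on e S g, {in S', g =1 f} & g p = - \sum_(z in S' | e q z) f z].
Proof.
move=> nf.
pose g z := if z == q then 0 else
  if z == p then - \sum_(z in S' | e q z) f z else f z.
have gE : {in S', g =1 f}.
  by move=> z; rewrite in_leaf /g => /and3P[/negbTE -> /negbTE -> _].
have gp : g p = - \sum_(z in S' | e q z) f z.
  by rewrite /g (negbTE leaf_neq) eqxx.
exists g; split=> //; apply/null_on_leaf; split.
- by rewrite /g eqxx.
- by rewrite gp; congr (- _); apply: eq_bigr => z /andP[/gE ->].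
- by apply: null_on_eq nf => z /gE.
Qed.

(** Null vectors of [S] restrict to [S'], and those of [S'] extend to [S]. *)
Lemma mem_supp_leaf z : z \in S' -> (z \in supp R e S) = (z \in supp R e S').
Proof.
move=> zS'; have zS : z \in S by move: zS'; rewrite in_leaf => /and3P[].
apply/mem_suppP/mem_suppP => -[f [_ nf fz]].
  by exists f; split=> //; case/null_on_leaf: nf.
have [g [ng gE _]] := null_on_leaf_extend nf.
by exists g; split=> //; rewrite gE.
Qed.

Lemma leaf_neighbour_notin_supp : q \notin supp R e S.
Proof.
by apply/mem_suppP => -[f [_ /null_on_leaf[-> _ _]]]; rewrite eqxx.
Qed.

(* Distinct neighbours of [q] lie in distinct components of [S'], so a null
   vector cut down to one component cannot cancel in the equation at [q]. *)
Lemma leaf_in_supp : acyclic_in e S ->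
  (p \in supp R e S) = [exists w in supp R e S', e q w].
Proof.
move=> acS; apply/mem_suppP/existsP => [[f [_ /null_on_leaf[_ fp nf] fp0]]|[w]].
  apply: contrapT => nw; move: fp0; rewrite fp oppr_eq0 big1 ?eqxx // => z.
  move=> /andP[zS' qz]; apply/eqP; apply: contrapT => /negP fz; apply: nw.
  by exists z; rewrite qz andbT; apply/mem_suppP; exists f.
move=> /andP[/mem_suppP[f [wS' nf fw]] qw].
have [g [ng _ gp]] := null_on_leaf_extend (null_on_component w nf).
exists g; split=> //; rewrite gp oppr_eq0.
rewrite (bigD1 w) /=; last by rewrite wS'.
rewrite connect0 big1 ?addr0 // => z /andP[/andP[zS' qz] zw].
case: ifP => // wz; exfalso.
have dis : [disjoint [set q] & S'] by rewrite disjoints1 in_leaf eqxx andbF.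
have zq : e z q by rewrite e_sym.
have neq : (q != q) || (w != z) by rewrite eq_sym zw orbT.
(* A path in [S'] from [w] to another neighbour [z] of [q], closed through [q], would be a cycle in
   [S]. *)
have [c cc [_ _ sc]] := join_cycle dis (set11 q) wS' (connect0 _ q) wz qw zq neq.
apply: (acS c cc) => y /sc; rewrite in_setU => /orP[/set1P -> //|].
by rewrite in_leaf => /and3P[].
Qed.

End Leaf.

(** * Duality and the support formula for forests *)

Lemma mem_N_forest S x : (x \in N_forest R e S) =
  [&& x \in S, x \notin supp R e S & ~~ [exists v in supp R e S, e v x]].
Proof. by rewrite !inE negb_and negb_or; case: (x \in S); rewrite ?andbF ?andbT. Qed.

(* Koenig-type duality: [M] certifies that [I] is a maximum independent set. *)
Lemma forest_duality S : acyclic_in e S ->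
  exists I M, [/\ I \subset S, independent e I, matching e S M,
    (#|I| + #|M| = #|S|)%N & (2 * #|I| = 2 * #|supp R e S| + #|N_forest R e S|)%N].
Proof.
have [n leSn] := ubnP #|S|; elim: n S leSn => // n IH S leSn acS.
(* Edgeless case: every vertex is in the support and the [N]-forest is empty. *)
have [noe|] := pselect {in S &, forall x y, ~~ e x y}.
  exists S, set0; split=> //.
  - exact/independentP.
  - by apply/matchingP; split=> [m|]; [rewrite inE|apply/trivIsetP => A B; rewrite inE].
  - by rewrite cards0 addn0.
  - rewrite supp_edgeless // (_ : N_forest R e S = set0) ?cards0 ?addn0 //.
    by apply/setP => x; rewrite mem_N_forest supp_edgeless // inE; case: (x \in S).
move=> hase; have [|p [q [pS qS pq leaf]]] := acyclic_leaf e_sym e_irr acS.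
  apply: contrapT => noe; apply: hase => x y xS yS; apply/negP => xy.
  by apply: noe; exists x, y; rewrite /adj_in /= xS yS.
have cardS := leaf_card pS qS pq.
have inS' := in_leaf S p q.
have nadj := leaf_nonadj leaf.
have suppS' := mem_supp_leaf pS qS pq leaf.
have qsupp := leaf_neighbour_notin_supp pS qS pq leaf.
have psupp := leaf_in_supp pS qS pq leaf acS.
set S' := S :\: [set p; q] in cardS inS' nadj suppS' psupp.
have subS : S' \subset S by apply: subsetDl.
have [I [M [IS' /independentP indI mM IM eqI]]] :
    exists I M, [/\ I \subset S', independent e I, matching e S' M,
    (#|I| + #|M| = #|S'|)%N & (2 * #|I| = 2 * #|supp R e S'| + #|N_forest R e S'|)%N].
  apply: IH; last exact: acyclic_inS acS.
  by move: leSn; rewrite cardS => /ltnW.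
have pS' : p \notin S' by rewrite inS' eqxx.
have qS' : q \notin S' by rewrite inS' eqxx andbF.
have pI : p \notin I by apply: contra pS' => /(subsetP IS').
have [mM' cM'] : matching e S ([set [set p; q]] :|: M) /\
    #|[set [set p; q]] :|: M| = (#|[set [set p; q]]| + #|M|)%N.
  apply: matchingU.
  - by apply: matching1; rewrite /adj_in /= pS qS.
  - exact: matchingS mM.
  - rewrite cover1 disjoint_sym; apply: disjointWl (matching_cover mM) _.
    by rewrite -setI_eq0 /S' setDE -setIA [_ :&: [set _; _]]setIC setICr setI0.
(* The leaf joins [I] and its edge joins [M], matching the two vertices put back. *)
exists (p |: I), ([set [set p; q]] :|: M); split=> //.
- by rewrite subUset sub1set pS (subset_trans IS').
- apply/independentP => x y /setU1P[->|xI] /setU1P[->|yI].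
  + by rewrite e_irr.
  + by rewrite nadj // (subsetP IS').
  + by rewrite e_sym nadj // (subsetP IS').
  + exact: indI.
- by rewrite cM' cards1 cardsU1 pI addnACA IM cardS.
rewrite cardsU1 pI mulnDr eqI.
have pNq : p != q by exact: leaf_neq pq.
(* Putting [p] and [q] back can add only [p] to the support. *)
have suppE z : (z \in supp R e S) = (p \in supp R e S) && (z == p) || (z \in supp R e S').
  have [zS'|zS'] := boolP (z \in S').
    by rewrite suppS' //; case: eqP => [zp|_]; [rewrite -zp zS' in pS'|rewrite andbF].
  have -> : (z \in supp R e S') = false.
    by apply: contraNF zS' => /(subsetP (supp_sub _)).
  rewrite orbF; have [->|zp] := eqVneq z p; rewrite ?andbT ?andbF //.
  have [->|zq] := eqVneq z q; first exact: negbTE.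
  apply: contraNF zS' => /(subsetP (supp_sub _)) zS.
  by rewrite inS' zp zq.
have adjE z : z \in S' ->
    [exists v in supp R e S, e v z] = [exists v in supp R e S', e v z].
  move=> zS'; apply: eq_existsb => v; rewrite suppE.
  by case: (eqVneq v p) => [->|_]; rewrite ?andbF ?nadj // !andbF.
have psupp' : p \notin supp R e S' by apply: contra pS' => /(subsetP (supp_sub _)).
(* If [p] is in the support, [q] is its neighbour, so both lie in the [S]-forest: the support gains
   one vertex and the [N]-forest is unchanged. *)
have [pin|pnin] := boolP (p \in supp R e S).
  have -> : supp R e S = p |: supp R e S'.
    by apply/setP => z; rewrite suppE pin in_setU1.
  have -> : N_forest R e S = N_forest R e S'.
    apply/setP => z; rewrite !mem_N_forest.
    have [zS'|zS'] := boolP (z \in S').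
      by rewrite adjE // suppS' // (subsetP subS).
    have [->|zp] := eqVneq z p; first by rewrite pin andbF.
    have [->|zq] := eqVneq z q; last first.
      by apply: contraNF zS' => /and3P[zS _ _]; rewrite inS' zp zq.
    apply/negbTE/negP => /and3P[_ _ /negP[]]; apply/existsP; exists p.
    by rewrite pin.
  by rewrite cardsU1 psupp' mulnDr addnA.
have -> : supp R e S = supp R e S'.
  by apply/setP => z; rewrite suppE (negbTE pnin).
(* Otherwise neither [p] nor [q] is in the support or adjacent to it (for [q], by [psupp]), so both
   join the [N]-forest. *)
have -> : N_forest R e S = [set p; q] :|: N_forest R e S'.
  apply/setP => z; rewrite in_setU !mem_N_forest in_set2.
  have [zS'|zS'] := boolP (z \in S').
    have : (z \in S) by apply: (subsetP subS).
    move: (zS'); rewrite inS' => /and3P[/negbTE -> /negbTE -> _] ->.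
    by rewrite adjE // suppS'.
  have [->|zp] := eqVneq z p.
    rewrite pS pnin /=; apply/existsPn => v; rewrite negb_and -implybE.
    apply/implyP => vs.
    have vS : v \in S by apply: (subsetP (supp_sub _)).
    apply/negP; rewrite e_sym => /(leaf _ vS) vq.
    by rewrite vq (negbTE qsupp) in vs.
  have [->|zq] := eqVneq z q.
    rewrite qS qsupp /=; apply/existsPn => v; rewrite negb_and -implybE; apply/implyP.
    rewrite suppE (negbTE pnin) /= => vs; apply/negP => vq.
    by move: pnin; rewrite psupp => /existsP[]; exists v; rewrite vs e_sym.
  by apply: contraNF zS' => /and3P[zS _ _]; rewrite inS' zp zq.
rewrite cardsU cards2 pNq (_ : _ :&: _ = set0) ?cards0 ?subn0 1?addnCA //.
apply/setP => z; rewrite in_setI in_set2 mem_N_forest in_set0.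
by apply/negP => /andP[/orP[] /eqP ->]; rewrite ?(negbTE pS') ?(negbTE qS').
Qed.

End Support.

(** * Connected components and counting over them *)

Section Components.
Variables (T : finType) (e : rel T).
Hypotheses (e_sym : symmetric e) (e_irr : irreflexive e).
Implicit Types (S A K : {set T}) (M : {set {set T}}).

Lemma connect_in_equiv S : {in S & &, equivalence_rel (connect (adj_in e S))}.
Proof.
move=> x y z _ _ _; split; first exact: connect0.
by move=> xy; rewrite (same_connect (connect_in_sym e_sym S) xy).
Qed.

Lemma mem_component S K u z : K \in components e S -> u \in K ->
  (z \in K) = (z \in S) && connect (adj_in e S) u z.
Proof.
move=> /imsetP[x xS ->]; rewrite !inE => /andP[uS xu].
by rewrite (same_connect (connect_in_sym e_sym S) xu).
Qed.

Lemma component_sub S K : K \in components e S -> K \subset S.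
Proof. by move=> /imsetP[x xS ->]; apply/subsetP => z; rewrite inE => /andP[]. Qed.

Lemma component_closed S K x y : K \in components e S -> x \in K -> y \in S ->
  e x y -> y \in K.
Proof.
move=> cK xK yS xy; rewrite (mem_component _ cK xK) yS connect1 //.
by rewrite /adj_in /= (subsetP (component_sub cK)) // yS.
Qed.

Lemma component_eq S K K' x : K \in components e S -> K' \in components e S ->
  x \in K -> x \in K' -> K = K'.
Proof.
move=> cK cK' xK xK'; apply/setP => z.
by rewrite (mem_component z cK xK) (mem_component z cK' xK').
Qed.

Lemma card_components S A :
  #|A :&: S| = (\sum_(K in components e S) #|A :&: K|)%N.
Proof.
have cardI B : #|A :&: B| = (\sum_(x in B) (x \in A))%N.
  rewrite -sum1_card big_mkcond [RHS]big_mkcond; apply: eq_bigr => x _.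
  by rewrite in_setI; case: (x \in A); case: (x \in B).
rewrite cardI (set_partition_big _ (equivalence_partitionP (@connect_in_equiv S))).
by apply: eq_bigr => K _; rewrite cardI.
Qed.

Lemma card_cover_matching S M : matching e S M -> #|cover M| = (2 * #|M|)%N.
Proof.
move=> /matchingP[sM /eqP <-]; rewrite mulnC -sum_nat_const.
apply: eq_bigr => m /sM [x [y [-> /and3P[_ _ xy]]]].
by rewrite cards2; case: eqP xy => // ->; rewrite e_irr.
Qed.

End Components.

(** * Pendant trees and the mismatched root *)

Section PendantTree.
Variables (T : finType) (e : rel T).
Hypotheses (e_sym : symmetric e) (e_irr : irreflexive e).
Variables (C : {set T}) (v : T).
Hypothesis vC : v \in C.

Let P := pendant_tree e C v.

Lemma pendant_treeP : [/\ connected_in e P, P :&: C = [set v] &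
  forall S, connected_in e S -> S :&: C = [set v] -> (#|S| <= #|P|)%N].
Proof.
rewrite /P /pendant_tree; case: arg_maxnP => [|S /andP[cS /eqP SC] maxS].
  apply/andP; split; last by rewrite (setIidPl _) // sub1set.
  apply/andP; split; first by apply/set0Pn; exists v; rewrite inE.
  apply/forall_inP => x /set1P ->; apply/forall_inP => y /set1P ->.
  exact: connect0.
by split=> // S' cS' S'C; apply: maxS; rewrite cS' S'C eqxx.
Qed.

Lemma pendant_tree_cycle x : x \in P -> x \in C -> x = v.
Proof.
have [_ PC _] := pendant_treeP => xP xC.
by apply/set1P; rewrite -PC inE xP.
Qed.

Lemma pendant_tree_root : v \in P.
Proof.
have [_ PC _] := pendant_treeP.
by have := set11 v; rewrite -PC inE => /andP[].
Qed.

(** Adding [y] would keep the set connected and its intersection with [C] equal to [[set v]], so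
    maximality forces [y] into [P]. *)
Lemma pendant_tree_closed x y : x \in P -> y \notin C -> e x y -> y \in P.
Proof.
have [/andP[_ /forall_inP conP] PC maxP] := pendant_treeP.
move=> xP yC xy; apply: contrapT => /negP yP.
suff : (#|y |: P| <= #|P|)%N by rewrite cardsU1 yP ltnn.
have xto z : z \in y |: P -> connect (adj_in e (y |: P)) x z.
  move=> /setU1P[->|zP].
    by apply: connect1; rewrite /adj_in /= !in_setU1 eqxx xP orbT.
  have /forall_inP/(_ z zP) := conP x xP.
  apply: connect_sub => a b /and3P[aP bP ab]; apply: connect1.
  by rewrite /adj_in /= !in_setU1 aP bP ab !orbT.
apply: maxP.
  apply/andP; split; first by apply/set0Pn; exists y; rewrite setU11.
  apply/forall_inP => a aP; apply/forall_inP => b bP.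
  apply: connect_trans (xto b bP).
  by rewrite (connect_in_sym e_sym); apply: xto.
rewrite setIUl PC (_ : [set y] :&: C = set0) ?set0U //.
by apply/setP => z; rewrite !inE; case: eqP => // ->; apply: negbTE.
Qed.

(** The edge [uv] brings [u] into [P], and closure under adjacency off [C] then brings in the rest
    of [K]. *)
Lemma component_sub_pendant_tree K u : K \in components e (~: C) ->
  u \in K -> e u v -> K \subset P.
Proof.
move=> cK uK uv; have sK := subsetP (component_sub cK).
have uP : u \in P.
  apply: (pendant_tree_closed pendant_tree_root); last by rewrite e_sym.
  by have := sK u uK; rewrite inE.
have clP : closed (adj_in e (~: C)) (mem P).
  move=> a b /and3P[]; rewrite !inE => aC bC ab.
  apply/idP/idP => [aP|bP]; first exact: pendant_tree_closed aP _ ab.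
  by apply: pendant_tree_closed bP _ _; rewrite // e_sym.
apply/subsetP => z; rewrite (mem_component e_sym z cK uK) => /andP[_ uz].
by have <- : (u \in P) = (z \in P) := closed_connect clP uz.
Qed.

(* A maximum matching of [K] missing [u], together with the edge [uv], would
   enlarge a maximum matching of the pendant tree that misses [v]. *)
Lemma mismatched_attachment K u M1 : K \in components e (~: C) ->
    u \in K -> e u v -> mismatched e P v -> matching e (K :\ u) M1 ->
  exists2 M, matching e K M & (#|M1| < #|M|)%N.
Proof.
move=> cK uK uv [M [mM maxM] vM] mM1; apply: contrapT => nolarger.
have sK := component_sub_pendant_tree cK uK uv.
have KC z : z \in K -> z \notin C by move=> /(subsetP (component_sub cK)); rewrite inE.
pose Min := [set m in M | m \subset K]; pose Mout := [set m in M | ~~ (m \subset K)].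
have /matchingP[eM tM] := mM.
have mMin : matching e K Min.
  apply/matchingP; split; last first.
    by apply: trivIsetS tM; apply/subsetP => m; rewrite inE => /andP[].
  move=> m; rewrite inE => /andP[/eM [x [y [-> /and3P[_ _ xy]]]] mK].
  exists x, y; split=> //; rewrite /adj_in /= xy andbT.
  by rewrite !(subsetP mK) // !inE eqxx ?orbT.
have mMout : matching e P Mout.
  by apply: matching_sub mM; apply/subsetP => m; rewrite inE => /andP[].
(* The edges of [M] inside [K] form a matching of [K], to which the negated conclusion applies. *)
have leMin : (#|Min| <= #|M1|)%N.
  by rewrite leqNgt; apply/negP => lt; apply: nolarger; exists Min.
have cardM : #|M| = (#|Min| + #|Mout|)%N.
  rewrite -(cardsID [set m : {set T} | m \subset K] M); congr (_ + _)%N;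
    apply: eq_card => m; by rewrite !inE // andbC.
(* As [v] is the only vertex of [C] in [P] and is unsaturated, edges of [M] avoid [C]; one that
   meets [K] therefore lies inside [K]. *)
have outK z : z \in cover Mout -> z \notin v |: K.
  move=> /bigcupP[m]; rewrite inE => /andP[mM' mK] zm.
  have PnC a : a \in m -> a \in P -> a \notin C.
    move=> am aP; apply/negP => aC; case/negP: vM.
    by rewrite -(pendant_tree_cycle aP aC); apply/bigcupP; exists m.
  have zv : z != v.
    by apply: contraNneq vM => <-; apply/bigcupP; exists m.
  rewrite in_setU1 (negbTE zv) /=; apply: contra mK => zK.
  have [x [y [mE /and3P[xP yP xy]]]] := eM m mM'.
  have xC : x \in ~: C by rewrite inE PnC // mE !inE eqxx.
  have yC : y \in ~: C by rewrite inE PnC // mE !inE eqxx orbT.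
  move: zm zK; rewrite mE => /set2P[] -> zK; rewrite subUset !sub1set zK ?andbT /=.
    exact: (component_closed e_sym cK zK yC xy).
  by rewrite e_sym in xy; apply: (component_closed e_sym cK zK xC xy).
have vK : v \notin K by apply/negP => /KC; rewrite vC.
have dis1 : [disjoint cover [set [set u; v]] & cover M1].
  rewrite cover1 disjoint_sym; apply: disjointWl (matching_cover mM1) _.
  rewrite -setI_eq0; apply/eqP/setP => z; rewrite !inE.
  have [//|zu] := eqVneq z u.
  by have [->|zv] := eqVneq z v; rewrite ?andbF // (negbTE vK).
have mM1P : matching e P M1.
  by apply: matchingS mM1; apply: subset_trans sK; apply: subD1set.
have muv : matching e P [set [set u; v]].
  by apply: matching1; rewrite /adj_in /= uv pendant_tree_root (subsetP sK).
have [mN cN] := matchingU muv mM1P dis1.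
have dis2 : [disjoint cover Mout & cover ([set [set u; v]] :|: M1)].
  rewrite disjoint_sym disjoints_subset; apply/subsetP => z zN.
  rewrite inE; apply: contraL zN => /outK; apply: contra.
  rewrite /cover bigcup_setU in_setU -!/(cover _) cover1 => /orP[/set2P[] ->|].
  - by rewrite in_setU1 uK orbT.
  - by rewrite in_setU1 eqxx.
  - by move=> /(subsetP (matching_cover mM1)); rewrite !inE => /andP[_ ->]; rewrite orbT.
(* Replacing [Min] by [M1] and the edge [uv] gives a matching of [P] larger than the maximum
   matching [M]. *)
have [/maxM] := matchingU mMout mN dis2.
move=> le cE; move: le; rewrite cE cN cards1 cardM [(#|Min| + _)%N]addnC leq_add2l.
by rewrite add1n ltnNge leMin.
Qed.

End PendantTree.

(** * Vertices of a cycle *)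

(** Recovers the vertex set from the edge set, so uniqueness of the edge set gives uniqueness of the
    vertex set. *)
Lemma cover_cycle_edges (T : finType) (c : seq T) :
  cover (cycle_edges c) = [set x in c].
Proof.
apply/setP => z; rewrite inE; apply/bigcupP/idP => [[m /imsetP[x xc ->]]|zc].
  by rewrite !inE => /orP[] /eqP -> //; rewrite mem_next.
by exists [set z; next c z]; [apply/imsetP; exists z|rewrite !inE eqxx].
Qed.

(** The successor map of the cycle is injective and sends the vertices of [A] on the cycle to cycle
    vertices outside [A]. *)
Lemma independent_cycle_bound (T : finType) (e : rel T) (c : seq T)
    (A : {set T}) : ucycle e c -> independent e A ->
  (#|A :&: [set x in c]| <= #|[set x in c]| %/ 2)%N.
Proof.
move=> /andP[cyc uc] /independentP indA; set C := [set x in c].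
have imE : #|next c @: (A :&: C)| = #|A :&: C|.
  exact: card_imset (can_inj (prev_next uc)).
rewrite leq_divRL // muln2 -addnn -{2}imE.
rewrite -(cardsID A C) setIC leq_add2l.
apply/subset_leq_card/subsetP => _ /imsetP[x xAC ->].
move: xAC; rewrite !inE => /andP[xc xA]; rewrite mem_next xc andbT; apply/negP => nA.
by have := indA _ _ xA nA; rewrite next_cycle.
Qed.

(** * The independence number of a unicyclic graph of Type II *)

Section Unicyclic.
Variables (R : realType) (T : finType) (e : rel T).
Hypotheses (e_sym : symmetric e) (e_irr : irreflexive e).
Variable c : seq T.
Hypothesis c_cycle : graph_cycle e c.
Hypothesis c_unique :
  forall c', graph_cycle e c' -> cycle_edges c' = cycle_edges c.

Let C := [set x in c].

Lemma unicyclic_mem c' : graph_cycle e c' -> c' =i c.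
Proof.
move=> /c_unique eqE x; have := cover_cycle_edges c'.
by rewrite eqE cover_cycle_edges => /setP/(_ x); rewrite !inE.
Qed.

Lemma unicyclic_acyclic (S : {set T}) x : x \in c -> x \notin S -> acyclic_in e S.
Proof.
move=> xc xS c' cc' sc'; case/negP: xS; apply: sc'.
by rewrite (unicyclic_mem cc').
Qed.

Lemma cycle_root : exists x, x \in c.
Proof. by case: c_cycle; case: c => // x s _ _; exists x; rewrite mem_head. Qed.

Lemma unicyclic_acyclicC : acyclic_in e (~: C).
Proof.
have [x xc] := cycle_root; apply: (unicyclic_acyclic xc).
by rewrite !inE xc.
Qed.

Lemma connect_cycle_in x y : x \in C -> y \in C -> connect (adj_in e C) x y.
Proof.
rewrite !inE => xc yc; have [_ /andP[cyc _]] := c_cycle.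
apply: (@connect_cycle _ _ c) => //.
apply: (@sub_in_cycle _ (mem C) e) cyc; last by apply/allP => z zc; rewrite [_ z]inE.
by move=> a b aC bC ab; apply/and3P.
Qed.

(** Two distinct attachment vertices would give a cycle running through [~: C] from [u] to [u'] and
    back through [C]; it contains [u], which is not on [c]. *)
Lemma attachment_unique K u u' v v' : K \in components e (~: C) ->
  u \in K -> u' \in K -> v \in C -> v' \in C -> e u v -> e u' v' -> u = u'.
Proof.
move=> cK uK u'K vC v'C uv u'v'; apply: contrapT => /eqP neq.
have uC : u \in ~: C by apply: (subsetP (component_sub cK)).
have uu' : connect (adj_in e (~: C)) u u'.
  by move: u'K; rewrite (mem_component e_sym _ cK uK) => /andP[].
have dis : [disjoint ~: C & C] by rewrite -setI_eq0 setIC setICr.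
rewrite e_sym in uv.
have [|c' cc' [uc' _ _]] := join_cycle dis uC v'C uu' (connect_cycle_in v'C vC) u'v' uv.
  by rewrite neq.
by move: uC; rewrite !inE -(unicyclic_mem cc') uc'.
Qed.

(* Since [C] minus a vertex is acyclic, its duality gives the bound without
   having to discuss chords. *)
Lemma cycle_independent : exists J : {set T},
  [/\ J \subset C, independent e J & #|J| = (#|C| %/ 2)%N].
Proof.
have [x xc] := cycle_root; have xC : x \in C by rewrite inE.
have [I [M [IC indI mM IM _]]] : exists (I : {set T}) M,
    [/\ I \subset C :\ x, independent e I, matching e (C :\ x) M,
     (#|I| + #|M| = #|C :\ x|)%N
     & (2 * #|I| = 2 * #|supp R e (C :\ x)| + #|N_forest R e (C :\ x)|)%N].
  apply: forest_duality => //; apply: (unicyclic_acyclic xc).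
  by rewrite !inE eqxx.
have IC' : I \subset C by apply: subset_trans IC (subD1set _ _).
exists I; split=> //; apply/eqP; rewrite eqn_leq; apply/andP; split.
  rewrite -{1}(setIidPl IC'); apply: independent_cycle_bound indI.
  by case: c_cycle.
(* Here [2 * #|M|] is at most [#|C| - 1], which equals [#|I| + #|M|]; hence [2 * #|I|] is at least
   [#|C| - 1]. *)
have := subset_leq_card (matching_cover mM).
rewrite (card_cover_matching e_irr mM) => leM.
rewrite -ltnS ltn_divLR // (cardsD1 x) xC -IM; move: leM; rewrite -IM.
lia.
Qed.

Hypothesis c_typeII : typeII e C.

(** If [K] has a vertex [u] adjacent to [C], a maximum independent set of [K :\ u] is used: it has
    no neighbour on [C], and Type II makes it as large as a maximum one of [K]. *)
Lemma component_independent K : K \in components e (~: C) ->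
  exists I : {set T}, [/\ I \subset K, independent e I,
    forall A : {set T}, A \subset K -> independent e A -> (#|A| <= #|I|)%N,
    {in I & C, forall x y, ~~ e x y}
    & (2 * #|I| = 2 * #|supp R e K| + #|N_forest R e K|)%N].
Proof.
move=> cK; have acK : acyclic_in e K.
  exact: acyclic_inS (component_sub cK) unicyclic_acyclicC.
have [I [M [IK indI mM IM eqI]]] := forest_duality R e_sym e_irr acK.
have maxI (A : {set T}) : A \subset K -> independent e A -> (#|A| <= #|I|)%N.
  move=> AK indA; have := independent_matching_bound AK indA mM.
  by rewrite -IM leq_add2r.
have [[u [v [uK vC uv]]]|noadj] :=
    pselect (exists u v, [/\ u \in K, v \in C & e u v]); last first.
  exists I; split=> // x y xI yC; apply/negP => xy; apply: noadj; exists x, y.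
  by split=> //; apply: (subsetP IK).
have [I1 [M1 [I1K indI1 mM1 IM1 _]]] :=
  forest_duality R e_sym e_irr (acyclic_inS (subD1set K u) acK).
have mis : mismatched e (pendant_tree e C v) v.
  by apply: contrapT => nmis; apply: c_typeII; exists v.
have [N mN ltN] := mismatched_attachment e_sym vC cK uK uv mis mM1.
have leN := independent_matching_bound IK indI mN.
have I1K' : I1 \subset K by apply: subset_trans I1K (subD1set _ _).
(* From [#|I| + #|N| <= #|K| = #|I1| + #|M1| + 1] and [#|M1| < #|N|] follows [#|I| <= #|I1|]. *)
have eqI1 : #|I1| = #|I|.
  apply/eqP; rewrite eqn_leq maxI //=; move: leN ltN.
  rewrite (cardsD1 u K) uK -IM1; lia.
exists I1; split=> //; rewrite ?eqI1 // => x y xI yC; apply/negP => xy.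
have /setD1P[/eqP xu xK] := subsetP I1K x xI.
by apply: xu; apply: attachment_unique cK xK uK yC vC xy uv.
Qed.

(** Independent sets are counted separately on [C] and on each component. The second identity is
    doubled to remain in the natural numbers. *)
Lemma alpha_unicyclic : exists I : {set T} -> {set T},
  alpha e = (#|C| %/ 2 + \sum_(K in components e (~: C)) #|I K|)%N /\
  {in components e (~: C), forall K,
    2 * #|I K| = 2 * #|supp R e K| + #|N_forest R e K|}%N.
Proof.
have /choice[I IP] : forall K, exists I : {set T}, K \in components e (~: C) ->
  [/\ I \subset K, independent e I,
    forall A : {set T}, A \subset K -> independent e A -> (#|A| <= #|I|)%N,
    {in I & C, forall x y, ~~ e x y}
    & (2 * #|I| = 2 * #|supp R e K| + #|N_forest R e K|)%N].
  move=> K; have [/component_independent[I IP]|nK] := boolP (K \in components e (~: C)).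
    by exists I.
  by exists set0.
exists I; split; last by move=> K /IP[].
apply/eqP; rewrite eqn_leq; apply/andP; split.
  (* Upper bound: each piece of an independent set is bounded on its own. *)
  apply/bigmax_leqP => A indA.
  rewrite -(cardsID C A) setDE (card_components e_sym (~: C)) leq_add //.
    by apply: independent_cycle_bound indA; case: c_cycle.
  apply: leq_sum => K /IP[_ _ maxI _ _]; apply: maxI; first exact: subsetIr.
  exact: independentS (subsetIl _ _) indA.
have [J [JC /independentP indJ <-]] := cycle_independent.
(* Lower bound: the optimal pieces are united; the sets [I K] send no edge to [C], and adjacent
   vertices off [C] share a component. *)
pose A := J :|: \bigcup_(K in components e (~: C)) I K.
have indA : independent e A.
  apply/independentP => x y /setUP[xJ|/bigcupP[K cK xK]] /setUP[yJ|/bigcupP[K' cK' yK']].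
  - exact: indJ.
  - by have [_ _ _ nadj _] := IP _ cK'; rewrite e_sym nadj // (subsetP JC).
  - by have [_ _ _ nadj _] := IP _ cK; rewrite nadj // (subsetP JC).
  have [IK /independentP indK _ _ _] := IP _ cK; have [IK' _ _ _ _] := IP _ cK'.
  apply/negP => xy; have yKc := subsetP IK' _ yK'; have xKc := subsetP IK _ xK.
  have yC := subsetP (component_sub cK') _ yKc.
  have eqK := component_eq e_sym cK' cK yKc (component_closed e_sym cK xKc yC xy).
  by rewrite eqK in yK'; have := indK _ _ xK yK'; rewrite xy.
apply: leq_trans (leq_bigmax_cond _ indA).
rewrite -(cardsID C A) setDE (card_components e_sym (~: C)) leq_add //.
  by apply: subset_leq_card; rewrite subsetI JC subsetUl.
apply: leq_sum => K cK; have [IK _ _ _ _] := IP _ cK; apply: subset_leq_card.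
rewrite subsetI IK andbT; apply: subset_trans (subsetUr _ _).
exact: bigcup_sup.
Qed.

End Unicyclic.

Theorem theorem4p9 (R : realType) (T : finType) (e : rel T)
    (e_sym : symmetric e) (e_irr : irreflexive e)
    (e_unicyclic : unicyclic e)
    (c : seq T) (c_cycle : graph_cycle e c)
    (e_typeII : typeII e [set x in c]) :
  (alpha e)%:R =
    (#|[set x in c]| %/ 2)%:R +
    \sum_(K in components e (~: [set x in c]))
       (#|supp R e K|%:R + #|N_forest R e K|%:R / 2%:R) :> R.
Proof.
(* The given [c] has the same edges as the cycle [c0] supplied by [unicyclic], so uniqueness
   transfers to it. *)
have c_unique c' : graph_cycle e c' -> cycle_edges c' = cycle_edges c.
  by case: e_unicyclic => _ [c0 _ uniq0] /uniq0 ->; rewrite (uniq0 c).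
have [I [-> IE]] := alpha_unicyclic R e_sym e_irr c_cycle c_unique e_typeII.
rewrite natrD natr_sum; congr (_ + _); apply: eq_bigr => K cK.
(* Each summand is multiplied by 2 to reach the identity [IE] between natural numbers. *)
have two_neq0 : 2%:R != 0 :> R by rewrite pnatr_eq0.
apply: (mulfI two_neq0); rewrite mulrDr mulrCA divff // mulr1.
by rewrite -!natrM -natrD IE.
Qed.
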